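(* Let $q$ be a prime power, let $n>1$ be an integer, and let $V\subseteq \mathbb{F}_{q^n}$ be any $\mathbb{F}_q$-vector subspace. Then there exist an integer $t\ge 2$ and a $t$-nilpotent linearized polynomial $L(x)\in\mathbb{F}_{q^n}[x]$ over $\mathbb{F}_{q^n}$ such that $V=V_L$ if, and only if, $V\ne \{0\}$ and $V\neq \mathbb{F}_{q^n}$.
   Context: A polynomial $L(x)\in \mathbb{F}_{q^n}[x]$ is linearized if it has the form $L(x)=\sum_{i=0}^{k}a_ix^{q^i}$ with $a_i\in\mathbb{F}_{q^n}$. $L^{(t)}(x)$ denotes the ordinary polynomial composition of $L(x)$ with itself $t$ times. For an integer $t\ge 2$, $L(x)\in\mathbb{F}_{q^n}[x]$ is a $t$-nilpotent linearized polynomial ($t$-NLP) over $\mathbb{F}_{q^n}$ if $L(x)$ is linearized, $L(x)\not\equiv 0\pmod{x^{q^n}-x}$ and $L^{(t)}(x)\equiv 0\pmod{x^{q^n}-x}$. The value set of $L$ is $V_L=\{L(z) : z\in\mathbb{F}_{q^n}\}$. *)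

(* Defs.v *)
From HB Require Import structures.
From mathcomp Require Import all_boot all_order all_algebra all_field.

Set Implicit Arguments.
Unset Strict Implicit.
Unset Printing Implicit Defensive.

Import GRing.Theory.
Local Open Scope ring_scope.

Definition linearized (q : nat) (K : fieldType) (P : {poly K}) : Prop :=
  exists (k : nat) (a : nat -> K), P = \sum_(i < k.+1) a i *: 'X^(q ^ i).

Definition comp_iter (K : fieldType) (t : nat) (P : {poly K}) : {poly K} :=
  iter t (fun Q => P \Po Q) 'X.

(* Meant for K with q ^ n elements; congruence to 0 modulo X^(q^n) - X is
   divisibility by that polynomial. *)
Definition nlp (q n t : nat) (K : fieldType) (P : {poly K}) : Prop :=
  [/\ (2 <= t)%N,
      linearized q P,
      ~ ('X^(q ^ n) - 'X %| P)
    & 'X^(q ^ n) - 'X %| comp_iter t P].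

Definition value_set (K : fieldType) (P : {poly K}) (y : K) : Prop :=
  exists z : K, P.[z] = y.

(* Main.v *)
(** An F-linear endomorphism of K is the evaluation map of exactly one
    linearized polynomial of degree less than q^n: the Moore matrix
    (b_j^(q^i)) of a basis of K over F is invertible, because a linearized
    polynomial of degree less than q^n cannot have q^n roots unless it is 0.
    The theorem thus reduces to linear algebra.  A nilpotent map on a nonzero
    space is not surjective, and it is nonzero iff its image is.  Conversely,
    for a basis v_1, ..., v_m of V and a vector w outside V, the map sending
    w to v_1, each v_i to v_(i+1), v_m to 0 and killing a complement of
    <w, v_1, ..., v_m> has image V, and its (m+1)-st power vanishes. *)
Require Import Defs.
From HB Require Import structures.
From mathcomp Require Import all_boot all_order all_algebra all_field.

Set Implicit Arguments.
Unset Strict Implicit.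
Unset Printing Implicit Defensive.

Import GRing.Theory.
Local Open Scope ring_scope.

Lemma horner_comp_iter (K : fieldType) (t : nat) (P : {poly K}) (x : K) :
  (comp_iter t P).[x] = iter t (horner P) x.
Proof.
by elim: t => [|t IHt]; rewrite /comp_iter /= ?hornerX // horner_comp IHt.
Qed.

Section LinearizedPolynomials.

Variables (F : finFieldType) (K : fieldExtType F).
Local Notation q := #|F|.
Local Notation n := (\dim {:K}).

(** Since [K] has q^n elements, X^(q^n) - X is the product of the distinct factors X - z over all z
    in [K]. *)
Lemma dvdp_vanishing (P : {poly K}) :
  reflect (forall x, P.[x] = 0) ('X^(q ^ n) - 'X %| P).
Proof.
pose finK := FinFieldExtType K.
have cardK : #|finK| = (q ^ n)%N.
  rewrite -(@card_vspacef F finK (Vector.class K)).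
  exact: card_vspace.
have XE : 'X^(q ^ n) - 'X = \prod_(z <- enum finK) ('X - z%:P) :> {poly K}.
  by rewrite -cardK (finField_genPoly finK) -big_enum.
apply: (iffP idP) => [dvdP x | P0].
  apply/rootP; rewrite -dvdp_XsubCl; apply: dvdp_trans dvdP.
  by rewrite XE dvdp_XsubCl root_prod_XsubC (mem_enum finK).
rewrite XE uniq_roots_dvdp // ?uniq_rootsE ?(enum_uniq finK) //.
by apply/allP => x _; apply/rootP.
Qed.

(** This makes x -> x^(q^i) additive on [K], by the Frobenius identity. *)
Lemma pnat_card_fieldExt : [pchar K].-nat q.
Proof.
have [p p_pr pF] := finPcharP F.
have [k ->] : exists k, q = (p ^ k)%N.
  exists (logn p #|F|).
  exact: (card_pprimeChar pF).
rewrite pnatX; apply/orP; left; rewrite (pnatE _ p_pr).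
by rewrite (pchar_lalg K).
Qed.

Lemma exprD_card_iter (i : nat) (x y : K) :
  (x + y) ^+ (q ^ i) = x ^+ (q ^ i) + y ^+ (q ^ i).
Proof. by rewrite exprDn_pchar // pnatX pnat_card_fieldExt. Qed.

Lemma exprZ_card_iter (i : nat) (a : F) (x : K) :
  (a *: x) ^+ (q ^ i) = a *: x ^+ (q ^ i).
Proof.
rewrite exprZn; congr (_ *: _).
by elim: i => [|i IHi]; rewrite ?expr1 // expnSr exprM IHi expf_card.
Qed.

Lemma horner_linearized_linear (P : {poly K}) :
  linearized q P -> linear (horner P).
Proof.
case=> k [a ->] c x y; rewrite !horner_sum scaler_sumr -big_split /=.
apply: eq_bigr => i _; rewrite !hornerZ !hornerXn.
by rewrite exprD_card_iter exprZ_card_iter mulrDr -scalerAr.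
Qed.

(** The sum is divisible by X^(q^n) - X but has degree below q^n, so it is 0; the exponents q^i are
    distinct, so each [a i] is one of its coefficients. *)
Lemma linearized_coef_eq0 (a : nat -> K) :
  (forall x, (\sum_(i < n) a i *: 'X^(q ^ i) : {poly K}).[x] = 0) ->
  forall i, (i < n)%N -> a i = 0.
Proof.
set P := \sum_(i < n) _ => P0 i lt_in.
have q_gt1 : (1 < q)%N := finNzRing_gt1 F.
have n_gt0 : (0 < n)%N := leq_ltn_trans (leq0n i) lt_in.
have sizeX : size ('X^(q ^ n) - 'X : {poly K}) = (q ^ n).+1.
  rewrite size_polyDl size_polyXn // size_polyN size_polyX ltnS.
  exact: (leq_trans q_gt1 (leq_pexp2l (ltnW q_gt1) n_gt0)).
have Peq0 : P = 0.
  apply/eqP; apply: contraTT isT => P_neq0.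
  have := dvdp_leq P_neq0 (introT (dvdp_vanishing P) P0).
  rewrite sizeX ltnNge (leq_trans (size_sum _ _ _)) //.
  apply/bigmax_leqP => j _; apply: leq_trans (size_scale_leq _ _) _.
  by rewrite size_polyXn ltn_exp2l.
have := congr1 (fun Q : {poly K} => Q`_(q ^ i)) Peq0.
rewrite coef0 coef_sum (bigD1 (Ordinal lt_in)) //= coefZ coefXn eqxx mulr1.
rewrite big1 ?addr0 // => j; rewrite -val_eqE /= => neq_ji.
by rewrite coefZ coefXn eqn_exp2l // eq_sym (negPf neq_ji) mulr0.
Qed.

Lemma linearized_of_linear (f : K -> K) :
  linear f -> exists2 P : {poly K}, linearized q P & horner P =1 f.
Proof.
move=> f_lin.
have n_gt0 : (0 < n)%N by rewrite adim_gt0.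
pose b := vbasis {:K}.
pose M := \matrix_(i < n, j < n) (b`_j) ^+ (q ^ i).
pose P (a : nat -> K) : {poly K} := \sum_(i < n) a i *: 'X^(q ^ i).
have linP a : linearized q (P a).
  by exists n.-1, a; rewrite prednK.
have ext (g h : K -> K) : linear g -> linear h ->
    (forall j : 'I_n, g b`_j = h b`_j) -> g =1 h.
  move=> g_lin h_lin gh x.
  pose gL := GRing.isLinear.Build F K K _ g g_lin.
  pose hL := GRing.isLinear.Build F K K _ h h_lin.
  pose g' : {linear K -> K} := HB.pack g gL.
  pose h' : {linear K -> K} := HB.pack h hL.
  rewrite -[g]/(g' : K -> K) -[h]/(h' : K -> K).
  rewrite (coord_vbasis (memvf x)) !linear_sum.
  by apply: eq_bigr => j _; rewrite !linearZ /= gh.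
(* Pads a row vector with zeros to a sequence indexed by [nat]. *)
pose c (v : 'rV[K]_n) k := oapp (v 0) 0 (insub k).
have Mb v j : (v *m M) 0 j = (P (c v)).[b`_j].
  rewrite mxE horner_sum; apply: eq_bigr => i _.
  by rewrite mxE hornerZ hornerXn /c valK.
(* A row killed by [M] gives a linearized polynomial vanishing on the basis, hence on [K], so its
   coefficients are 0. *)
have Mu : M \in unitmx.
  rewrite -row_free_unit; apply: inj_row_free => v vM0.
  have P0 : horner (P (c v)) =1 (fun=> 0).
    apply: ext => [|a x y|j]; first exact: horner_linearized_linear.
      by rewrite scaler0 addr0.
    by rewrite -Mb vM0 mxE.
  apply/rowP => i; rewrite mxE.
  by have := linearized_coef_eq0 P0 (ltn_ord i); rewrite /c valK.
exists (P (c ((\row_j f b`_j) *m invmx M))) => //.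
apply: ext => // [|j]; first exact: horner_linearized_linear.
by rewrite -Mb mulmxKV // mxE.
Qed.

End LinearizedPolynomials.

(* With out-of-range entries of a sequence read as 0, the shift along a free
   family w :: v_1 :: ... :: v_m sends its i-th entry to the (i+1)-st. *)
Lemma nilpotent_with_image (F : fieldType) (U : vectType F) (V : {vspace U}) :
  V != fullv ->
  exists f : {linear U -> U},
    (forall y, y \in V <-> exists x, f x = y) /\
    (forall x, iter (\dim V).+1 f x = 0).
Proof.
move=> Vproper; set m := \dim V.
have [w wV] : exists w, w \notin V.
  case: (subvPn (_ : ~~ (fullv <= V)%VS)) => [|w _ wV]; last by exists w.
  by apply: contra Vproper => ?; rewrite eqEsubv subvf.
pose X : m.+1.-tuple U := [tuple of w :: vbasis V].
have Xfree : free X.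
  by rewrite free_cons (span_basis (vbasisP V)) wV (basis_free (vbasisP V)).
(* Each [coord X i] is linear on all of [U], so no complement has to be chosen. *)
pose f x := \sum_(i < m.+1) coord X i x *: X`_i.+1.
have f_lin : linear f.
  move=> a x y; rewrite scaler_sumr -big_split; apply: eq_bigr => i _.
  by rewrite linearP scalerDl scalerA.
pose fL := GRing.isLinear.Build F U U _ f f_lin.
pose g : {linear U -> U} := HB.pack f fL.
have XV i : X`_i.+1 \in V.
  have [lt_im | le_mi] := ltnP i m; last first.
    by rewrite nth_default ?mem0v // size_tuple.
  by apply: vbasis_mem; apply: mem_nth; rewrite size_tuple.
have gX i : g X`_i = X`_i.+1.
  have [lt_im | le_mi] := ltnP i m.+1; last first.
    by rewrite !nth_default ?linear0 // size_tuple // leqW.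
  rewrite /= /f (bigD1 (Ordinal lt_im)) //=.
  rewrite (coord_free (Ordinal lt_im)) // eqxx scale1r big1 ?addr0 //.
  move=> j neq_ji; rewrite (coord_free (Ordinal lt_im)) // eq_sym.
  by rewrite (negPf neq_ji) scale0r.
have gV x : g x \in V by apply: memv_suml => i _; rewrite memvZ.
have coordV y : y \in V -> y = \sum_(i < m) coord (vbasis V) i y *: X`_i.+1.
  exact: coord_vbasis.
exists g; split=> [y | x].
  split=> [/coordV -> | [x <-] //].
  exists (\sum_(i < m) coord (vbasis V) i y *: X`_i).
  rewrite linear_sum; apply: eq_bigr => i _.
  by rewrite linearZ; congr (_ *: _); apply: gX.
have iterE k i : iter k g X`_i = X`_(k + i).
  by elim: k => //= k ->; apply: gX.
have iter_sum k (a : 'I_m -> F) (v : 'I_m -> U) :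
    iter k g (\sum_i a i *: v i) = \sum_i a i *: iter k g (v i).
  elim: k => // k IHk; rewrite iterS IHk linear_sum.
  by apply: eq_bigr => i _; rewrite iterS linearZ.
(* One application lands in [V], the span of the entries from index 1 on; m more push every index
   past m. *)
rewrite iterSr (coordV _ (gV x)) iter_sum big1 // => i _.
by rewrite iterE nth_default ?scaler0 // size_tuple addnS ltnS leq_addr.
Qed.

Theorem theorem1 (q n : nat) (F : finFieldType) (K : fieldExtType F)
    (hq : #|F| = q) (hn : (1 < n)%N) (hK : \dim {:K} = n) (V : {vspace K}) :
  (exists (t : nat) (P : {poly K}),
      nlp q n t P /\ (forall y : K, y \in V <-> value_set P y))
  <-> V <> 0%VS /\ V <> fullv.
Proof.
subst q n; split=> [[t [P [[_ _ ndvdP /dvdp_vanishing nilP] VP]]] | [V0 V1]].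
  split=> V_eq.
    apply: ndvdP; apply/dvdp_vanishing => x; apply/eqP.
    by rewrite -memv0 -V_eq; apply/VP; exists x.
  (* If [V] is everything, all iterates are onto, yet the [t]-th one is 0 and misses 1. *)
  have surj k y : exists x, iter k (horner P) x = y.
    elim: k y => [|k IHk] y; first by exists y.
    have [|z <-] := (VP y).1; first by rewrite V_eq memvf.
    by have [x <-] := IHk z; exists x.
  have [x] := surj t 1; rewrite -horner_comp_iter nilP.
  by move/esym/eqP; rewrite oner_eq0.
have [|f [Vf f_nil]] := @nilpotent_with_image F K V; first exact/eqP.
have [P linP Pf] := linearized_of_linear (linearP f).
exists (\dim V).+1, P; split; last first.
  move=> y; split=> [/Vf[x <-] | [x <-]]; first by exists x; apply: Pf.
  by apply/Vf; exists x; rewrite Pf.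
split=> //.
- by rewrite ltnS lt0n dimv_eq0; apply/eqP.
- move/dvdp_vanishing => P0; apply: V0; apply/eqP; rewrite -subv0.
  by apply/subvP => y /Vf[x <-]; rewrite -Pf P0 mem0v.
- apply/dvdp_vanishing => x; rewrite horner_comp_iter -[RHS](f_nil x).
  exact: eq_iter.
Qed.
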